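(* Let $\Omega:\mathbb M_m\to\mathbb M_n$ be completely positive with minimal Kraus representation $\Omega(B)=\sum_{i=1}^r V_i^*BV_i$ (so $V_1,\dots,V_r$ are linearly independent), and let $\Lambda:\mathbb M_\ell\to\mathbb M_m$ be completely positive with a (not necessarily minimal) Kraus representation $\Lambda(A)=\sum_{j=1}^s L_j^*AL_j$. Assume $\Omega\circ\Lambda\ne0$. Let $$\mathcal R_{\Lambda,\Omega}=\Big\{c=(c_{ji})\in\mathbb C^s\otimes\mathbb C^r:\ \sum_{j=1}^s\sum_{i=1}^r c_{ji}\,L_jV_i=0\Big\},\qquad \mathcal E_{\Lambda,\Omega}=\mathcal R_{\Lambda,\Omega}^{\perp}\subseteq\mathbb C^s\otimes\mathbb C^r,$$ and let $P_{\mathcal E}$ be the orthogonal projection of $\mathbb C^s\otimes\mathbb C^r$ onto $\mathcal E_{\Lambda,\Omega}$. Let $P=[p_{ij}]\in\mathbb M_r$ be a projection and let $\Omega_P\le\Omega$, $\Omega_P(B)=\sum_{i,j}p_{ij}V_i^*BV_j$, be the corresponding sharp submap. Then the following are equivalent: (1) the pullback $\Omega_P\circ\Lambda\le\Omega\circ\Lambda$ is sharp (relative to $\Omega\circ\Lambda$); (2) $\mathcal T_\Lambda^\Omega(P)$ is a projection; (3) $\mathcal E_{\Lambda,\Omega}$ reduces $I_s\otimes P$; (4) $P_{\mathcal E}(I_s\otimes P)=(I_s\otimes P)P_{\mathcal E}$.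
   Context: For completely positive maps, $\Phi\le\Psi$ means $\Psi-\Phi$ is completely positive. Radon--Nikodym theorem (known): if $\Psi(C)=T^*\sigma(C)T$ is a minimal Stinespring representation of a completely positive map and $\Phi$ is completely positive with $\Phi\le c\,\Psi$ for some $c\ge0$, there is a unique positive $E$ in the commutant of the range of $\sigma$ with $\Phi(C)=T^*\sigma(C)ET$ for all $C$; it is denoted $\frac{\mathrm d\Phi}{\mathrm d\Psi}$. A completely positive $\Phi\le\Psi$ is sharp relative to $\Psi$ if $\frac{\mathrm d\Phi}{\mathrm d\Psi}$ is a projection. With $(f_i)$ the standard basis of $\mathbb C^r$, the minimal Stinespring representation of $\Omega$ is $\pi_\Omega(B)=B\otimes I_r$ on $\mathbb C^m\otimes\mathbb C^r$ with $\mathsf V_\Omega\xi=\sum_iV_i\xi\otimes f_i$, and $D\in\mathbb M_r$ is identified with $I_m\otimes D\in\pi_\Omega(\mathbb M_m)'$; for $D=[d_{ij}]\ge0$, $\Omega_D(B)=\mathsf V_\Omega^*(B\otimes I_r)(I_m\otimes D)\mathsf V_\Omega=\sum_{i,j}d_{ij}V_i^*BV_j$. One has $\Omega\circ\Lambda(A)=\sum_{j,i}(L_jV_i)^*A(L_jV_i)$, and the coefficient space of the family $\{L_jV_i\}$ is $\mathbb C^s\otimes\mathbb C^r$. Restricting this coefficient space to $\mathcal E_{\Lambda,\Omega}$ removes the linear redundancies of the family, and the minimal Stinespring representation of $\Omega\circ\Lambda$ is taken on $\mathbb C^\ell\otimes\mathcal E_{\Lambda,\Omega}$ with $A\mapsto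 A\otimes I_{\mathcal E_{\Lambda,\Omega}}$; an operator $X\in B(\mathcal E_{\Lambda,\Omega})$ is identified with $I_\ell\otimes X$ in the commutant. The pullback transfer map is $\mathcal T_\Lambda^\Omega(D)=\frac{\mathrm d(\Omega_D\circ\Lambda)}{\mathrm d(\Omega\circ\Lambda)}\in B(\mathcal E_{\Lambda,\Omega})$ for $D\ge0$ (derivative with respect to the minimal Stinespring representation of $\Omega\circ\Lambda$), extended linearly to $\mathbb M_r$. A subspace reduces an operator if it is invariant under the operator and its adjoint.
   Formalization: The complement of R is taken for the bilinear pairing Σ c_ji x_ji, not the Hermitian one (so E is the entrywise conjugate of the printed E), since the printed equivalence fails, e.g. for V_i=e_i in C^2, L=[1,1+i]. *)

(* Defs.v *)
(* MathComp, with the classical sets of MathComp-Analysis. *)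
From mathcomp Require Import all_boot all_order all_algebra.
From mathcomp Require Import sesquilinear spectral.
From mathcomp Require Import boolp classical_sets reals.
From mathcomp Require Import mxtens complex.

Set Implicit Arguments.
Unset Strict Implicit.
Unset Printing Implicit Defensive.

Import Order.TTheory GRing.Theory Num.Theory.

Local Open Scope ring_scope.
Local Open Scope sesquilinear_scope.
Local Open Scope classical_set_scope.

Section Operators.
Variable C : numClosedFieldType.

(* [0 <= z] in [C] says that [z] is real and nonnegative, so a positive
   operator is automatically self-adjoint. *)
Definition positive_op d (A : 'M[C]_d) : Prop :=
  forall x : 'cV[C]_d, 0 <= (x^t* *m A *m x) 0 0.

Definition projection_op d (Q : 'M[C]_d) : Prop := Q^t* = Q /\ Q *m Q = Q.

(* Operators act on column vectors. *)
Definition invariant_under d (U : set 'cV[C]_d) (A : 'M[C]_d) : Prop :=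
  forall x, U x -> U (A *m x).

Definition reduces d (U : set 'cV[C]_d) (A : 'M[C]_d) : Prop :=
  invariant_under U A /\ invariant_under U (A^t*).

Definition is_orthogonal_projection d (U : set 'cV[C]_d) (Q : 'M[C]_d) : Prop :=
  projection_op Q /\ (forall x, U x <-> Q *m x = x).

(* This is 0 if [U] is not a subspace. *)
Definition orthogonal_projection d (U : set 'cV[C]_d) : 'M[C]_d :=
  xget 0 [set Q | is_orthogonal_projection U Q].

End Operators.

Section CompletelyPositive.
Variable C : numClosedFieldType.
Variables m n : nat.

(* An element of M_k(M_m) is given by its k x k family of m x m blocks. *)
Definition completely_positive (Phi : 'M[C]_m -> 'M[C]_n) : Prop :=
  linear Phi /\
  forall (k : nat) (A : 'I_k -> 'I_k -> 'M[C]_m),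
    positive_op (\mxblock_(i < k, j < k) A i j) ->
    positive_op (\mxblock_(i < k, j < k) Phi (A i j)).

Definition cp_le (Phi Psi : 'M[C]_m -> 'M[C]_n) : Prop :=
  completely_positive (Psi \- Phi).

(* A finite-dimensional Hilbert space is taken to be a subspace K of some
   'cV[C]_d, and an operator on K is the d x d matrix which acts as this
   operator on K and vanishes on the orthogonal complement of K.  A
   representation of 'M_m on K is thus a map into 'M_d whose value at the
   identity matrix is the orthogonal projection onto K. *)
Definition star_representation d (sigma : 'M[C]_m -> 'M[C]_d) : Prop :=
  [/\ linear sigma,
      forall A B, sigma (A *m B) = sigma A *m sigma B
    & forall A, sigma (A^t*) = (sigma A)^t*].

(* The equation [sigma 1%:M *m T = T] says that T takes its values in K. *)
Definition stinespring d (sigma : 'M[C]_m -> 'M[C]_d) (T : 'M[C]_(d, n))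
    (Psi : 'M[C]_m -> 'M[C]_n) : Prop :=
  [/\ star_representation sigma,
      sigma 1%:M *m T = T
    & forall A, Psi A = T^t* *m sigma A *m T].

(* Minimality: the vectors sigma(A) T xi span K. *)
Definition minimal_stinespring d (sigma : 'M[C]_m -> 'M[C]_d)
    (T : 'M[C]_(d, n)) (Psi : 'M[C]_m -> 'M[C]_n) : Prop :=
  stinespring sigma T Psi /\
  forall X : {vspace 'cV[C]_d},
    (forall A (xi : 'cV[C]_n), sigma A *m T *m xi \in X) ->
    forall x : 'cV[C]_d, sigma 1%:M *m x \in X.

(* E = dPhi/dPsi with respect to a minimal Stinespring representation
   (sigma, T) of Psi.  The equation [sigma 1%:M *m E = E] says that E is an
   operator on K. *)
Definition is_RN_derivative d (sigma : 'M[C]_m -> 'M[C]_d) (T : 'M[C]_(d, n))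
    (Phi : 'M[C]_m -> 'M[C]_n) (E : 'M[C]_d) : Prop :=
  [/\ positive_op E,
      sigma 1%:M *m E = E,
      forall A, E *m sigma A = sigma A *m E
    & forall A, Phi A = T^t* *m sigma A *m E *m T].

(* As minimal Stinespring representations of Psi are unitarily equivalent,
   whether the derivative is a projection does not depend on the choice. *)
Definition sharp (Psi Phi : 'M[C]_m -> 'M[C]_n) : Prop :=
  [/\ completely_positive Phi, cp_le Phi Psi
    & exists d (sigma : 'M[C]_m -> 'M[C]_d) (T : 'M[C]_(d, n)) (E : 'M[C]_d),
        [/\ minimal_stinespring sigma T Psi,
            is_RN_derivative sigma T Phi E
          & projection_op E]].

End CompletelyPositive.

Section Transfer.
Variable C : numClosedFieldType.
Variables l m n r s : nat.
Variable V : 'I_r -> 'M[C]_(m, n).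
Variable L : 'I_s -> 'M[C]_(l, m).
Variable Lam : 'M[C]_l -> 'M[C]_m.

Definition kraus (B : 'M[C]_m) : 'M[C]_n := \sum_i (V i)^t* *m B *m V i.

Definition submap (D : 'M[C]_r) (B : 'M[C]_m) : 'M[C]_n :=
  \sum_i \sum_j D i j *: ((V i)^t* *m B *m V j).

(* The coefficient space C^s (x) C^r is 'cV_(s * r); [mxtens_index (j, i)] is
   the position of the coefficient c_{ji}, in accordance with [*t]. *)
Definition relations : set 'cV[C]_(s * r) :=
  [set c | \sum_j \sum_i c (mxtens_index (j, i)) 0 *: (L j *m V i) = 0].

(* The complement of [relations] is taken for the bilinear pairing
   sum_{j,i} c_{ji} x_{ji}, in which the relations are linear functionals: it
   is the Hermitian orthogonal complement of the complex conjugates of the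
   relations.  This makes [coefficient_space] the smallest subspace E such that
   the range of [dilation] lies in C^l (x) E, that is, the space on which the
   minimal Stinespring representation of the composite lives.  The Hermitian
   complement of [relations] itself does not have this property; it is the
   entrywise conjugate of [coefficient_space]. *)
Definition coefficient_space : set 'cV[C]_(s * r) :=
  [set x | forall c, relations c -> c^T *m x = 0].

Definition coefficient_proj : 'M[C]_(s * r) :=
  orthogonal_projection coefficient_space.

(* xi |-> sum_{j,i} L_j V_i xi (x) (e_j (x) f_i) *)
Definition dilation : 'M[C]_(l * (s * r), n) :=
  \matrix_(p, b)
    let: (a, q) := mxtens_unindex p in
    let: (j, i) := mxtens_unindex q in
    (L j *m V i) a b.

(* A |-> A (x) I on C^l (x) coefficient_space *)
Definition composite_rep (A : 'M[C]_l) : 'M[C]_(l * (s * r)) :=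
  A *t coefficient_proj.

(* The linear map D |-> d(Omega_D o Lam)/d(Omega o Lam), its values being
   operators on [coefficient_space].  The condition on positive D determines it
   as soon as 0 < l, since positive matrices span 'M_r. *)
Definition transfer_map : 'Hom('M[C]_r, 'M[C]_(s * r)) :=
  xget 0 [set T : 'Hom('M[C]_r, 'M[C]_(s * r)) |
    forall D : 'M[C]_r, positive_op D ->
      is_RN_derivative composite_rep dilation (submap D \o Lam)
        (1%:M *t T D)].

End Transfer.

(* Main.v *)
(** Let [W] be the dilation and [Q] the projection onto the coefficient space.
    Then [A |-> A (x) Q] with [W] is a minimal Stinespring representation of
    [Omega \o Lambda], and [submap V D \o Lambda] is
    [A |-> W^* (A (x) (1 (x) D)) W], so its derivative is
    [1 (x) (Q (1 (x) D) Q)].  A compression [Q P' Q] of a projection [P'] is a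
    projection if and only if [Q] and [P'] commute. *)
Require Import Defs.
From HB Require Import structures.
From mathcomp Require Import all_boot all_order all_algebra.
From mathcomp Require Import sesquilinear spectral.
From mathcomp Require Import boolp classical_sets reals.
From mathcomp Require Import mxtens complex.

Import Order.TTheory GRing.Theory Num.Theory.

Local Open Scope ring_scope.
Local Open Scope complex_scope.

(** * Adjoints, Kronecker products, positive operators and projections *)

Section Adjoint.
Set Implicit Arguments.
Unset Strict Implicit.
Local Open Scope sesquilinear_scope.
Variable C : numClosedFieldType.

Lemma adjmxE p q (A : 'M[C]_(p, q)) i j : A^t* i j = (A j i)^*%R.
Proof. by rewrite !mxE. Qed.

Lemma adjmx_mul p q t (A : 'M[C]_(p, q)) (B : 'M[C]_(q, t)) :
  (A *m B)^t* = B^t* *m A^t*.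
Proof. by rewrite trmx_mul map_mxM. Qed.

Lemma adjmxB p q (A B : 'M[C]_(p, q)) : (A - B)^t* = A^t* - B^t*.
Proof. by rewrite linearB map_mxB. Qed.

Lemma adjmx1 d : (1%:M : 'M[C]_d)^t* = 1%:M.
Proof. by rewrite trmx1 map_mx1. Qed.

Lemma adjmx_sum p q I (s : seq I) (F : I -> 'M[C]_(p, q)) :
  (\sum_(i <- s) F i)^t* = \sum_(i <- s) (F i)^t*.
Proof. by rewrite linear_sum raddf_sum. Qed.

Lemma adjmxZ p q a (A : 'M[C]_(p, q)) : (a *: A)^t* = a^* *: A^t*.
Proof. by rewrite linearZ /= map_mxZ. Qed.

Lemma adjmx_tens p q p' q' (A : 'M[C]_(p, q)) (B : 'M[C]_(p', q')) :
  (A *t B)^t* = A^t* *t B^t*.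
Proof. by rewrite trmx_tens map_mxT. Qed.

Lemma adjmx_mul_ge0 d (x : 'cV[C]_d) : 0 <= (x^t* *m x) 0 0.
Proof. by rewrite mxE sumr_ge0 // => i _; rewrite !mxE mulrC mul_conjC_ge0. Qed.

Lemma adjmx_mul_eq0 p q (A : 'M[C]_(p, q)) : A^t* *m A = 0 -> A = 0.
Proof.
move=> A0; apply/matrixP => i j; rewrite mxE; apply/eqP.
have ge0 k : true -> 0 <= A^t* j k * A k j.
  by rewrite !mxE mulrC mul_conjC_ge0.
have /matrixP/(_ j j) := A0; rewrite !mxE => /(psumr_eq0P ge0)/(_ i isT) /eqP.
by rewrite !mxE mulf_eq0 conjC_eq0 orbb.
Qed.

Lemma sum_mxtens_index (U : nmodType) k d (F : 'I_(k * d) -> U) :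
  \sum_p F p = \sum_a \sum_q F (mxtens_index (a, q)).
Proof.
rewrite pair_big (reindex (@mxtens_index k d)) /=.
  by apply: eq_bigr => -[].
by exists (@mxtens_unindex k d) => p _; rewrite (mxtens_indexK, mxtens_unindexK).
Qed.

(** The block of [1 (x) X] at index 0 is [X] itself; for [k = 0] there is no such block. *)
Lemma tens1mx_inj k p q : (0 < k)%N ->
  injective (fun X : 'M[C]_(p, q) => (1%:M : 'M[C]_k) *t X).
Proof.
case: k => // k _ X Y /matrixP eqXY; apply/matrixP => i j.
have := eqXY (mxtens_index (0, i)) (mxtens_index (0, j)).
by rewrite !tensmxE !mxE !mul1r.
Qed.

Lemma tensmx_linearr k l p q (A : 'M[C]_(k, l)) :
  linear (fun B : 'M[C]_(p, q) => A *t B).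
Proof.
move=> a B B'; apply/matrixP => i j; rewrite !mxE.
by rewrite mulrDr mulrCA.
Qed.

Lemma tensmx_linearl k l p q (B : 'M[C]_(p, q)) :
  linear (fun A : 'M[C]_(k, l) => A *t B).
Proof. by move=> a A A'; apply/matrixP => i j; rewrite !mxE mulrDl mulrA. Qed.

Lemma tens1mx1 k l : (1%:M : 'M[C]_k) *t (1%:M : 'M[C]_l) = 1%:M.
Proof.
apply/matrixP => p q; case: (mxtens_indexP p) => i j.
case: (mxtens_indexP q) => i' j'; rewrite tensmxE !mxE -natrM mulnb.
by rewrite (can_eq (@mxtens_indexK _ _)) xpair_eqE.
Qed.

Lemma projection_op1B d (Q : 'M[C]_d) :
  projection_op Q -> projection_op (1%:M - Q).
Proof.
case=> Qh Qi; split; first by rewrite adjmxB adjmx1 Qh.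
by rewrite mulmxBl mulmxBr !mul1mx mulmxBr mulmx1 Qi subrr subr0.
Qed.

Lemma projection_op_tens k d (P : 'M[C]_k) (Q : 'M[C]_d) :
  projection_op P -> projection_op Q -> projection_op (P *t Q).
Proof.
by case=> Ph Pi [Qh Qi]; split; rewrite ?adjmx_tens ?tensmx_mul ?Ph ?Pi ?Qh ?Qi.
Qed.

Lemma projection_op1 d : projection_op (1%:M : 'M[C]_d).
Proof. by split; rewrite ?adjmx1 ?mul1mx. Qed.

Lemma projection_op_tens1 k d (X : 'M[C]_d) : (0 < k)%N ->
  projection_op ((1%:M : 'M[C]_k) *t X) -> projection_op X.
Proof.
move=> k0 []; rewrite adjmx_tens adjmx1 => /(tens1mx_inj k0) Xh.
by rewrite tensmx_mul mul1mx => /(tens1mx_inj k0).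
Qed.

Lemma positive_op_conj p q (A : 'M[C]_p) (X : 'M[C]_(p, q)) :
  positive_op A -> positive_op (X^t* *m A *m X).
Proof. by move=> A_ge0 x; have := A_ge0 (X *m x); rewrite adjmx_mul !mulmxA. Qed.

Lemma positive_op_projection d (Q : 'M[C]_d) : projection_op Q -> positive_op Q.
Proof.
move=> [Qh Qi] x; rewrite -Qi -{1}Qh mulmxA -adjmx_mul -mulmxA.
exact: adjmx_mul_ge0.
Qed.

(** The quadratic form of [1 (x) X] at [x] is the sum of the forms of [X] at the slices [xa a] of
    [x]. *)
Lemma positive_op_tens1 k d (X : 'M[C]_d) :
  positive_op X -> positive_op ((1%:M : 'M[C]_k) *t X).
Proof.
move=> X_ge0 x.
pose xa a : 'cV[C]_d := \col_q x (mxtens_index (a, q)) 0.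
suff -> : (x^t* *m (1%:M *t X) *m x) 0 0
    = \sum_a ((xa a)^t* *m X *m xa a) 0 0 by exact: sumr_ge0.
rewrite mxE sum_mxtens_index; apply: eq_bigr => a _; rewrite mxE; apply: eq_bigr => q _.
rewrite mxE sum_mxtens_index (bigD1 a) //= [X in _ + X]big1 => [|b neq_ba]; last first.
  apply: big1 => p _; rewrite tensmxE !mxE (negbTE neq_ba).
  by rewrite mul0r mulr0.
rewrite addr0 !mxE; congr (_ * _); apply: eq_bigr => p _.
by rewrite tensmxE !mxE eqxx mul1r.
Qed.

(* X = (1 - Q) P Q satisfies X^* X = Q P Q - (Q P Q)^2. *)
Lemma projection_op_compression d (P Q : 'M[C]_d) :
  projection_op P -> projection_op Q ->
  projection_op (Q *m P *m Q) <-> Q *m P = P *m Q.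
Proof.
move=> [Ph Pi] [Qh Qi]; split=> [[_ QPQi]|QP]; last first.
  rewrite QP -mulmxA Qi; split; first by rewrite adjmx_mul Ph Qh.
  by rewrite mulmxA -(mulmxA P) QP mulmxA Pi -mulmxA Qi.
have : P *m Q - Q *m P *m Q = 0.
  apply: adjmx_mul_eq0; rewrite adjmxB !adjmx_mul Ph Qh mulmxA.
  rewrite mulmxBl !mulmxBr !mulmxA -(mulmxA Q P P) Pi.
  (* Since [Q Q = Q], this is idempotence of the compression. *)
  have -> : Q *m P *m Q *m P *m Q = Q *m P *m Q.
    by rewrite -{2}QPQi !mulmxA -(mulmxA (Q *m P) Q Q) Qi.
  rewrite -(mulmxA (Q *m P) Q Q) Qi.
  have -> : Q *m P *m Q *m P *m Q = Q *m P *m Q.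
    by rewrite -{2}QPQi !mulmxA -(mulmxA (Q *m P) Q Q) Qi.
  by rewrite !subrr.
(* The right-hand side of [P Q = Q P Q] is self-adjoint, so [P Q] equals its adjoint [Q P]. *)
move/eqP; rewrite subr_eq0 => /eqP PQ; rewrite PQ.
by rewrite -{1}Ph -{1}Qh -adjmx_mul PQ !adjmx_mul Ph Qh mulmxA.
Qed.

End Adjoint.

(** * Complete positivity of Kraus maps and of sharp submaps *)

Section CompletelyPositive.
Set Implicit Arguments.
Unset Strict Implicit.
Local Open Scope sesquilinear_scope.
Variable C : numClosedFieldType.

Lemma adjmx_mxrow p k (q : 'I_k -> nat) (B : forall j, 'M[C]_(p, q j)) :
  (\mxrow_j B j)^t* = \mxcol_j (B j)^t*.
Proof. by rewrite tr_mxrow; apply/matrixP => i j; rewrite !mxE. Qed.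

Lemma kraus_linear m n r (V : 'I_r -> 'M[C]_(m, n)) : linear (kraus V).
Proof.
move=> a A B; rewrite /kraus scaler_sumr -big_split; apply: eq_bigr => i _ /=.
by rewrite mulmxDr mulmxDl -scalemxAr -scalemxAl.
Qed.

(** Blockwise application is [A |-> sum_t W_t^* A W_t], where [W t] is block diagonal with [V t] in
    every diagonal block, and each conjugation preserves positivity. *)
Lemma kraus_completely_positive m n r (V : 'I_r -> 'M[C]_(m, n)) :
  completely_positive (kraus V).
Proof.
split=> [|k A A_ge0]; first exact: kraus_linear.
pose W t := \mxblock_(i < k, j < k) (if i == j then V t else 0).
have WE t : (W t)^t* = \mxblock_(i < k, j < k) (if i == j then (V t)^t* else 0).
  rewrite tr_mxblock; apply/matrixP => p q; rewrite !mxE eq_sym.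
  by case: eqP; rewrite !mxE ?conjC0.
have -> : \mxblock_(i < k, j < k) kraus V (A i j) =
    \sum_t (W t)^t* *m \mxblock_(i < k, j < k) A i j *m W t.
  rewrite mxblock_sum; apply: eq_bigr => t _; rewrite WE !mul_mxblock.
  apply/eq_mxblockP => i j.
  rewrite (bigD1 j) //= eqxx [X in _ + X]big1 => [|j' /negbTE->]; last first.
    by rewrite mulmx0.
  rewrite (bigD1 i) //= eqxx big1 ?addr0 // => i'.
  by rewrite eq_sym => /negbTE->; rewrite mul0mx.
move=> x; rewrite mulmx_sumr mulmx_suml summxE; apply: sumr_ge0 => t _.
exact: positive_op_conj.
Qed.

Lemma completely_positive_comp l m n (Phi : 'M[C]_m -> 'M[C]_n)
    (Lam : 'M[C]_l -> 'M[C]_m) :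
  completely_positive Phi -> completely_positive Lam ->
  completely_positive (Phi \o Lam).
Proof.
move=> [linPhi Phi_ge0] [linLam Lam_ge0]; split=> [a A B|k A A_ge0].
  by rewrite /= linLam linPhi.
exact/Phi_ge0/Lam_ge0.
Qed.

(** Expand the right-hand side and use [P = P^* P], that is, [p_ij = sum_k conj(p_ki) p_kj]. The
    Kraus form obtained gives complete positivity. *)
Lemma submap_projection m n r (V : 'I_r -> 'M[C]_(m, n)) (P : 'M[C]_r) :
  projection_op P -> submap V P =1 kraus (fun k => \sum_j P k j *: V j).
Proof.
move=> [Ph Pi] B; rewrite /submap /kraus.
rewrite [RHS](eq_bigr (fun k => \sum_i \sum_j
    ((P k i)^* * P k j) *: ((V i)^t* *m B *m V j))); last first.
  move=> k _; rewrite adjmx_sum !mulmx_suml; apply: eq_bigr => i _.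
  rewrite mulmx_sumr; apply: eq_bigr => j _.
  by rewrite adjmxZ -!scalemxAl -scalemxAr scalerA.
rewrite [RHS]exchange_big; apply: eq_bigr => i _.
rewrite [RHS]exchange_big; apply: eq_bigr => j _.
rewrite -scaler_suml; congr (_ *: _).
have PP : P = P^t* *m P by rewrite Ph Pi.
by rewrite {1}PP mxE; apply: eq_bigr => k _; rewrite !mxE.
Qed.

Lemma submapB m n r (V : 'I_r -> 'M[C]_(m, n)) (D D' : 'M[C]_r) B :
  submap V (D - D') B = submap V D B - submap V D' B.
Proof.
rewrite /submap -sumrB; apply: eq_bigr => i _; rewrite -sumrB.
by apply: eq_bigr => j _; rewrite !mxE scalerBl.
Qed.

Lemma submap1 m n r (V : 'I_r -> 'M[C]_(m, n)) : submap V 1%:M =1 kraus V.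
Proof.
move=> B; apply: eq_bigr => i _; rewrite (bigD1 i) //= big1 => [|j neq_ji].
  by rewrite mxE eqxx scale1r addr0.
by rewrite mxE eq_sym (negbTE neq_ji) scale0r.
Qed.

Lemma submap_projection_completely_positive m n r (V : 'I_r -> 'M[C]_(m, n))
    (P : 'M[C]_r) :
  projection_op P -> completely_positive (submap V P).
Proof.
move/(submap_projection V)/funext ->; exact: kraus_completely_positive.
Qed.

(** The difference is the submap of the complementary projection [1 - P]. *)
Lemma submap_projection_le m n r (V : 'I_r -> 'M[C]_(m, n)) (P : 'M[C]_r) :
  projection_op P -> cp_le (submap V P) (kraus V).
Proof.
move=> Pproj; rewrite /cp_le.
have -> : kraus V \- submap V P = submap V (1%:M - P).
  by apply/funext => B; rewrite submapB submap1.
exact/submap_projection_completely_positive/projection_op1B.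
Qed.

End CompletelyPositive.

(** * Minimal Stinespring representations and Radon-Nikodym derivatives *)

Section Stinespring.
Set Implicit Arguments.
Unset Strict Implicit.
Local Open Scope sesquilinear_scope.
Variable C : numClosedFieldType.
Variables m n : nat.
Implicit Types (Phi Psi : 'M[C]_m -> 'M[C]_n).

Definition matrix_unit (k : 'I_(m * m)) : 'M[C]_m := vec_mx (delta_mx 0 k).

(* The columns are the vectors sigma(e_k) T xi, with e_k running over the
   matrix units and xi over the standard basis. *)
Definition orbit_mx d (sigma : 'M[C]_m -> 'M[C]_d) (T : 'M[C]_(d, n)) :=
  \mxrow_(k < m * m) (sigma (matrix_unit k) *m T).

(** With [M] the orbit matrix of a representation of [Psi], [M^* M] is [gram_mx Psi], and [M^* E M]
    is [gram_mx Phi] for a derivative [E] of [Phi]. Neither depends on the representation, which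
    allows different representations to be compared. *)
Definition gram_mx Phi :=
  \mxblock_(i < m * m, j < m * m)
    Phi ((matrix_unit i)^t* *m matrix_unit j).

Lemma matrix_unit_sum (A : 'M[C]_m) :
  A = \sum_k mxvec A 0 k *: matrix_unit k.
Proof.
rewrite -[LHS]mxvecK [in LHS](row_sum_delta (mxvec A)) linear_sum.
by apply: eq_bigr => k _; rewrite linearZ.
Qed.

Lemma mem_mulmx_vspace d q (M : 'M[C]_(d, q)) (X : {vspace 'cV[C]_d}) x :
  (forall j, col j M \in X) -> M *m x \in X.
Proof.
move=> MX; suff -> : M *m x = \sum_j x j 0 *: col j M.
  by apply: rpred_sum => j _; apply: rpredZ.
apply/colP => i; rewrite summxE mxE; apply: eq_bigr => j _.
by rewrite !mxE mulrC.
Qed.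

Section Representation.
Variables (d : nat) (sigma : 'M[C]_m -> 'M[C]_d) (T : 'M[C]_(d, n)).
Let M := orbit_mx sigma T.

Lemma mul_orbit_mx A (xi : 'cV[C]_n) : linear sigma ->
  exists x, sigma A *m T *m xi = M *m x.
Proof.
move=> lin_sigma.
pose f : {linear 'M[C]_m -> 'M[C]_d} :=
  HB.pack sigma (GRing.isLinear.Build _ _ _ _ _ lin_sigma).
have -> : sigma A = \sum_k mxvec A 0 k *: sigma (matrix_unit k).
  rewrite -[LHS]/(f A) {1}(matrix_unit_sum A) linear_sum.
  by apply: eq_bigr => k _; rewrite linearZ.
exists (\mxcol_k (mxvec A 0 k *: xi)); rewrite mul_mxrow_mxcol !mulmx_suml.
by apply: eq_bigr => k _; rewrite -!scalemxAl -scalemxAr.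
Qed.

(** Minimality says that the range of [sigma 1%:M] lies in the column space of [M]; the factor [Z]
    turns this inclusion into a matrix equation. *)
Lemma orbit_mx_minimal Psi :
  stinespring sigma T Psi ->
  minimal_stinespring sigma T Psi <-> exists Z, sigma 1%:M = M *m Z.
Proof.
move=> st; have [[lin_sigma _ _] _ _] := st; split=> [[_ minX]|[Z sigma1]].
  have range_s1 (x : 'cV_d) : exists y, sigma 1%:M *m x = M *m y.
    (* Minimality is applied to the column space of [M]. *)
    have /memv_imgP[y _ ->] : sigma 1%:M *m x \in limg (linfun (mulmx M)).
      apply: minX => A xi; have [y ->] := mul_orbit_mx A xi lin_sigma.
      by rewrite -[M *m y](lfunE (mulmx M)) memv_img ?memvf.
    by exists y; rewrite lfunE.
  have /submxP[D s1] : ((sigma 1%:M)^T <= M^T)%MS.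
    apply/row_subP => i; have [y s1y] := range_s1 (delta_mx i 0).
    by rewrite -tr_col colE s1y trmx_mul submxMl.
  by exists D^T; apply: trmx_inj; rewrite s1 trmx_mul trmxK.
split=> // X X_orbit x; rewrite sigma1 -mulmxA; apply: mem_mulmx_vspace => j.
rewrite /M /orbit_mx col_mxrow colE; exact: X_orbit.
Qed.

Lemma adjmx_orbit_mx_mul F :
  M^t* *m F *m M = \mxblock_(i < m * m, j < m * m)
    (T^t* *m sigma (matrix_unit i)^t* *m F *m sigma (matrix_unit j) *m T).
Proof.
rewrite adjmx_mxrow mxcol_mul mul_mxcol_mxrow.
by apply/eq_mxblockP => i j; rewrite adjmx_mul !mulmxA.
Qed.

Lemma gram_mx_stinespring Psi :
  stinespring sigma T Psi -> M^t* *m M = gram_mx Psi.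
Proof.
case=> st _ PsiE; rewrite -[M^t*]mulmx1 adjmx_orbit_mx_mul.
have [_ sigmaM sigma_adj] := st.
by apply/eq_mxblockP => i j; rewrite PsiE sigmaM sigma_adj mulmx1 !mulmxA.
Qed.

(** As [E] commutes with [sigma], block [(i, j)] is [T^* sigma(e_i^* e_j) E T]. *)
Lemma gram_mx_RN_derivative Phi E :
  star_representation sigma -> is_RN_derivative sigma T Phi E ->
  M^t* *m E *m M = gram_mx Phi.
Proof.
move=> st [_ _ Ecomm PhiE]; rewrite adjmx_orbit_mx_mul.
have [_ sigmaM sigma_adj] := st.
apply/eq_mxblockP => i j.
by rewrite PhiE sigmaM sigma_adj -!mulmxA (mulmxA E) Ecomm !mulmxA.
Qed.

Hypothesis st : star_representation sigma.
Hypothesis span : exists Z, sigma 1%:M = M *m Z.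

Lemma star_representation1_adj : (sigma 1%:M)^t* = sigma 1%:M.
Proof. by case: st => _ _ <-; rewrite adjmx1. Qed.

(** The projection [sigma 1%:M = M Z] is self-adjoint, so [F = sigma(1) F = Z^* M^* F]. *)
Lemma orbit_mx_eq0 p (F : 'M[C]_(d, p)) :
  sigma 1%:M *m F = F -> M^t* *m F = 0 -> F = 0.
Proof.
move=> sF MF; have [Z s1] := span.
by rewrite -sF -star_representation1_adj s1 adjmx_mul -mulmxA MF mulmx0.
Qed.

(** An operator on the space of the representation is determined by its sesquilinear form on the
    spanning vectors, the columns of [M]. *)
Lemma orbit_mx_sandwich_inj (E F : 'M[C]_d) :
  sigma 1%:M *m E = E -> E *m sigma 1%:M = E ->
  sigma 1%:M *m F = F -> F *m sigma 1%:M = F ->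
  M^t* *m E *m M = M^t* *m F *m M -> E = F.
Proof.
move=> sE Es sF Fs eqEF; have [Z s1] := span.
apply/eqP; rewrite -subr_eq0; apply/eqP.
rewrite -Es -Fs -mulmxBl; apply: orbit_mx_eq0.
  by rewrite mulmxA mulmxBr sE sF.
by rewrite s1 !mulmxA mulmxBr mulmxBl eqEF subrr mul0mx.
Qed.

End Representation.

Lemma RN_derivative_unique d (sigma : 'M[C]_m -> 'M[C]_d) (T : 'M[C]_(d, n))
    Phi Psi E F :
  minimal_stinespring sigma T Psi ->
  is_RN_derivative sigma T Phi E -> is_RN_derivative sigma T Phi F -> E = F.
Proof.
move=> mini RN_E RN_F; have [st _] := mini.
have [srep _ _] := st.
have [_ sE Ecomm _] := RN_E; have [_ sF Fcomm _] := RN_F.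
apply: (@orbit_mx_sandwich_inj _ sigma T) => //; try by rewrite ?Ecomm ?Fcomm.
  exact/orbit_mx_minimal/mini.
by rewrite (gram_mx_RN_derivative srep RN_E) (gram_mx_RN_derivative srep RN_F).
Qed.

(* No intertwiner is needed: since E leaves the range of M = orbit_mx sigma T
   invariant, E M = M Y for some Y, and both E M = M Y and E^2 = E are
   equations between the Gram matrices M^* M and M^* E M, which depend only
   on Psi and Phi. *)
Lemma RN_derivative_projection d d' (sigma : 'M[C]_m -> 'M[C]_d)
    (T : 'M[C]_(d, n)) (sigma' : 'M[C]_m -> 'M[C]_d') (T' : 'M[C]_(d', n))
    Phi Psi E E' :
  minimal_stinespring sigma T Psi -> minimal_stinespring sigma' T' Psi ->
  is_RN_derivative sigma T Phi E -> is_RN_derivative sigma' T' Phi E' ->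
  projection_op E -> projection_op E'.
Proof.
move=> mini mini' RN_E RN_E' [Eh Ei]; have [st _] := mini; have [st' _] := mini'.
have [srep _ _] := st; have [srep' T'E _] := st'.
have [_ sE Ecomm _] := RN_E; have [_ sE' Ecomm' _] := RN_E'.
have span := (orbit_mx_minimal st).1 mini.
have span' := (orbit_mx_minimal st').1 mini'.
have G := gram_mx_stinespring st; have G' := gram_mx_stinespring st'.
have H := gram_mx_RN_derivative srep RN_E.
have H' := gram_mx_RN_derivative srep' RN_E'.
set M := orbit_mx sigma T in G H; set M' := orbit_mx sigma' T' in G' H'.
have E's : E' *m sigma' 1%:M = E' by rewrite Ecomm'.
have s'h := star_representation1_adj srep'.
(* Self-adjointness passes from [E] to [E'] because [M'^* E' M' = M^* E M]. *)
have E'h : E'^t* = E'.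
  apply: (orbit_mx_sandwich_inj srep' span') => //.
  - by rewrite -{1}s'h -adjmx_mul E's.
  - by rewrite -{1}s'h -adjmx_mul sE'.
  rewrite -/M' H' -H.
  have -> : M'^t* *m E'^t* *m M' = (M'^t* *m E' *m M')^t*.
    by rewrite !adjmx_mul trmxCK mulmxA.
  by rewrite H' -H !adjmx_mul Eh trmxCK mulmxA.
split=> //.
(* From [E = sigma(1) E = M Z E] one gets [Y = Z E M]. *)
have [Y EM] : exists Y, E *m M = M *m Y.
  by have [Z s1] := span; exists (Z *m E *m M); rewrite !mulmxA -s1 sE.
have s'M' : sigma' 1%:M *m M' = M'.
  have [_ sigmaM _] := srep'.
  rewrite mul_mxrow; apply/eq_mxrowP => k.
  by rewrite mulmxA -sigmaM mul1mx.
(* The same [Y] works for [E']: [M'^* (E' M' - M' Y)] equals [M^* (E M - M Y) = 0]. *)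
have E'M' : E' *m M' = M' *m Y.
  apply/eqP; rewrite -subr_eq0; apply/eqP.
  apply: (orbit_mx_eq0 srep' span').
    by rewrite mulmxBr !mulmxA sE' s'M'.
  by rewrite -/M' mulmxBr !mulmxA H' G' -G -mulmxA -EM mulmxA H subrr.
apply: (orbit_mx_sandwich_inj srep' span') => //.
- by rewrite mulmxA sE'.
- by rewrite -mulmxA E's.
(* Here [M'^* E' E' M' = Y^* M'^* M' Y = Y^* M^* M Y = M^* E E M = M^* E M]. *)
rewrite -/M' H' -H mulmxA -mulmxA E'M' -{1}E'h -adjmx_mul E'M' adjmx_mul.
rewrite mulmxA -(mulmxA (Y^t*)) G' -G mulmxA -adjmx_mul -(mulmxA _ M) -EM.
by rewrite adjmx_mul Eh mulmxA -(mulmxA (M^t*) E E) Ei.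
Qed.

End Stinespring.

(** * Orthogonal projections onto column spaces *)

Section OrthogonalProjection.
Set Implicit Arguments.
Unset Strict Implicit.
Local Open Scope sesquilinear_scope.
Variable C : numClosedFieldType.

Lemma projection_op_tr d (P : 'M[C]_d) : projection_op P -> projection_op P^T.
Proof.
move=> [Ph Pi]; split; last by rewrite -trmx_mul Pi.
by apply/matrixP => i j; rewrite -{2}Ph !mxE.
Qed.

(** Self-adjointness follows from [P^* = P P^*], that is, [(1 - P) P^* = 0]: the rows of [1 - P] are
    orthogonal to those of [P]. *)
Lemma projection_op_proj_ortho p d (A : 'M[C]_(p, d)) :
  projection_op (proj_ortho A).
Proof.
set P := proj_ortho A; have Pi : P *m P = P by exact: proj_ortho_proj.
split=> //; suff PP : P^t* = P *m P^t*.
  by rewrite -[RHS]trmxCK PP (adjmx_mul P) trmxCK.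
apply/eqP; rewrite -subr_eq0 -{1}[P^t*]mul1mx -mulmxBl -orthomx1E.
rewrite (eqmx_ortho _ (proj_orthoE A)) -[P]mul1mx.
exact: proj_ortho_compl_sub.
Qed.

Lemma col_mulmx p q d (A : 'M[C]_(p, q)) (B : 'M[C]_(q, d)) j :
  col j (A *m B) = A *m col j B.
Proof. by rewrite !colE mulmxA. Qed.

(** Inclusion of column spaces is tested on row vectors annihilating [B]; the cokernel of [B^T]
    supplies enough of them. *)
Lemma mulmx_factor p q d (A : 'M[C]_(d, p)) (B : 'M[C]_(d, q)) :
  (forall y : 'rV_d, y *m B = 0 -> y *m A = 0) -> exists Z, A = B *m Z.
Proof.
move=> ker_sub; have /submxP[D AE] : (A^T <= B^T)%MS.
  rewrite submxE; apply/eqP/trmx_inj; rewrite trmx_mul trmxK trmx0.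
  apply/row_matrixP => i; rewrite row_mul row0; apply: ker_sub.
  have BK : (cokermx B^T)^T *m B = 0.
    by apply: trmx_inj; rewrite trmx_mul trmxK mulmx_coker trmx0.
  by rewrite -row_mul BK row0.
by exists D^T; apply: trmx_inj; rewrite AE trmx_mul trmxK.
Qed.

(** [proj_ortho] acts on row vectors, hence both transposes. *)
Lemma is_orthogonal_projection_range p d (A : 'M[C]_(d, p)) :
  is_orthogonal_projection [set x | exists z, x = A *m z]%classic
    (proj_ortho A^T)^T.
Proof.
split=> [|x]; first exact/projection_op_tr/projection_op_proj_ortho.
split=> [[z ->]|Qx] /=.
  apply: trmx_inj; rewrite trmx_mul trmxK proj_ortho_id // trmx_mul.
  exact: submxMl.
have /submxP[D xE] : (x^T <= A^T)%MS.
  by rewrite -Qx trmx_mul trmxK proj_ortho_sub.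
by exists D^T; apply: trmx_inj; rewrite xE trmx_mul trmxK.
Qed.

End OrthogonalProjection.

(** * The minimal representation of the composite and the transfer map *)

Section Composite.
Set Implicit Arguments.
Unset Strict Implicit.
Local Open Scope sesquilinear_scope.
Variable C : numClosedFieldType.
Variables l m n r s : nat.
Variable V : 'I_r -> 'M[C]_(m, n).
Variable L : 'I_s -> 'M[C]_(l, m).

Let F (q : 'I_(s * r)) : 'M[C]_(l, n) :=
  L (mxtens_unindex q).1 *m V (mxtens_unindex q).2.
Let Q := coefficient_proj V L.
Let W := dilation V L.

(** With the products [L_j V_i] vectorised as rows, [relations] is the left kernel of this matrix
    and [coefficient_space] its column space. *)
Definition product_mx := \matrix_(q < s * r) mxvec (F q).

Lemma product_mxE q a b : product_mx q (mxvec_index a b) = F q a b.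
Proof. by rewrite mxE mxvecE. Qed.

Lemma dilationE a q b : W (mxtens_index (a, q)) b = F q a b.
Proof. by rewrite mxE mxtens_indexK /F; case: (mxtens_unindex q). Qed.

Lemma relations_product_mx c : relations V L c <-> c^T *m product_mx = 0.
Proof.
rewrite /relations /=.
have -> : \sum_j \sum_i c (mxtens_index (j, i)) 0 *: (L j *m V i)
    = vec_mx (c^T *m product_mx).
  rewrite mulmx_sum_row linear_sum sum_mxtens_index; apply: eq_bigr => j _.
  apply: eq_bigr => i _.
  by rewrite linearZ /= rowK mxvecK /F mxtens_indexK mxE.
by split=> [/(congr1 mxvec)|->]; rewrite ?vec_mxK linear0.
Qed.

(** This is the double annihilator theorem for the bilinear pairing. *)
Lemma coefficient_space_range :
  coefficient_space V L = [set x | exists z, x = product_mx *m z]%classic.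
Proof.
apply/seteqP; split=> x /= => [Ex|[z ->] c /relations_product_mx Rc]; last first.
  by rewrite mulmxA Rc mul0mx.
apply: mulmx_factor => y yN; rewrite -[y]trmxK; apply: Ex.
by apply/relations_product_mx; rewrite trmxK.
Qed.

Lemma coefficient_projP :
  is_orthogonal_projection (coefficient_space V L) Q.
Proof.
rewrite /Q /coefficient_proj /orthogonal_projection; apply: (@xgetPex _ 0).
(* An explicit projection shows that [coefficient_proj] is not the default value 0. *)
exists (proj_ortho product_mx^T)^T; rewrite coefficient_space_range.
exact: is_orthogonal_projection_range.
Qed.

Let Qproj : projection_op Q. Proof. by case: coefficient_projP. Qed.

Lemma coefficient_spaceP x : coefficient_space V L x <-> Q *m x = x.
Proof. by case: coefficient_projP. Qed.

Lemma coefficient_proj_id k (B : 'M[C]_(s * r, k)) :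
  (forall j, coefficient_space V L (col j B)) -> Q *m B = B.
Proof.
move=> EB; apply/matrixP => i j.
have /coefficient_spaceP/colP/(_ i) := EB j.
by rewrite -col_mulmx mxE [RHS]mxE.
Qed.

Lemma coefficient_space_proj j : coefficient_space V L (col j Q).
Proof. by apply/coefficient_spaceP; rewrite -col_mulmx; case: Qproj => _ ->. Qed.

Lemma coefficient_proj_product_mx : Q *m product_mx = product_mx.
Proof.
apply: coefficient_proj_id => j; rewrite coefficient_space_range /=.
by exists (delta_mx j 0); rewrite colE.
Qed.

(** The columns of [Q] lie in [coefficient_space], where relations vanish as functionals. *)
Lemma relations_mul_proj c : relations V L c -> c^T *m Q = 0.
Proof.
move=> Rc; apply/matrixP => i j.
have /matrixP/(_ i 0) := coefficient_space_proj j Rc.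
by rewrite -col_mulmx !mxE.
Qed.

(** For fixed [a] and [b], the entries of [W] over [q] form a column of [product_mx], which [Q]
    fixes. *)
Lemma dilation_range : (1%:M *t Q) *m W = W.
Proof.
apply/matrixP => p b; case: (mxtens_indexP p) => a q.
rewrite dilationE -product_mxE -coefficient_proj_product_mx !mxE sum_mxtens_index.
rewrite (bigD1 a) //= [X in _ + X]big1 => [|a' neq_a'a]; last first.
  apply: big1 => q' _; rewrite tensmxE mxE eq_sym (negbTE neq_a'a).
  by rewrite !mul0r.
rewrite addr0; apply: eq_bigr => q' _.
by rewrite tensmxE mxE eqxx mul1r dilationE product_mxE.
Qed.

Lemma dilation_compression (A : 'M[C]_l) (X : 'M[C]_(s * r)) :
  W^t* *m (A *t X) *m W = \sum_q \sum_q' X q q' *: ((F q)^t* *m A *m F q').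
Proof.
apply/matrixP => b c; rewrite mxE sum_mxtens_index summxE.
under [RHS]eq_bigr do rewrite summxE.
rewrite [RHS]exchange_big [LHS]exchange_big; apply: eq_bigr => q' _ /=.
under [RHS]eq_bigr do rewrite mxE mxE mulr_sumr.
rewrite [RHS]exchange_big; apply: eq_bigr => a' _ /=.
rewrite dilationE mxE sum_mxtens_index exchange_big mulr_suml.
apply: eq_bigr => q _ /=; rewrite mulrA [in RHS]mxE; congr (_ * _).
rewrite mulr_sumr; apply: eq_bigr => a _.
by rewrite tensmxE !adjmxE dilationE [RHS]mulrCA [A a a' * _]mulrC mulrA.
Qed.

(** For [X = 1 (x) D] the terms with distinct [j] vanish, and the sum over the common [j] rebuilds
    [kraus L A]. *)
Lemma submap_kraus_dilation (D : 'M[C]_r) A :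
  submap V D (kraus L A) = W^t* *m (A *t (1%:M *t D)) *m W.
Proof.
rewrite dilation_compression sum_mxtens_index exchange_big /submap.
apply: eq_bigr => i _ /=.
under [RHS]eq_bigr do rewrite sum_mxtens_index exchange_big.
rewrite [RHS]exchange_big; apply: eq_bigr => i' _ /=.
rewrite /kraus mulmx_sumr mulmx_suml scaler_sumr; apply: eq_bigr => j _.
rewrite (bigD1 j) //= big1 => [|j' neq_j'j]; last first.
  by rewrite tensmxE mxE eq_sym (negbTE neq_j'j) mul0r scale0r.
rewrite tensmxE mxE eqxx mul1r addr0 /F !mxtens_indexK /=.
by rewrite adjmx_mul !mulmxA.
Qed.

Lemma composite_rep_star : star_representation (composite_rep V L).
Proof.
have [Qh Qi] := Qproj.
split=> [||A]; rewrite /composite_rep.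
- exact: tensmx_linearl.
- by move=> A B; rewrite tensmx_mul Qi.
- by rewrite adjmx_tens Qh.
Qed.

(** By [mulmx_factor], it suffices that a row vector annihilating the orbit matrix annihilates
    [1 (x) Q]. Each slice of such a vector is a relation, and [Q] kills relations. *)
Lemma composite_rep_minimal Psi :
  (forall A, Psi A = kraus V (kraus L A)) ->
  minimal_stinespring (composite_rep V L) W Psi.
Proof.
move=> PsiE; have st : stinespring (composite_rep V L) W Psi.
  split=> [||A]; [exact: composite_rep_star|exact: dilation_range|].
  rewrite PsiE -submap1 submap_kraus_dilation tens1mx1 /composite_rep.
  by rewrite -/Q (tensmx_decr A Q) -!mulmxA dilation_range.
apply/(orbit_mx_minimal st)/mulmx_factor => y yM.
pose c a : 'cV[C]_(s * r) := \col_q y 0 (mxtens_index (a, q)).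
have cQ a : (c a)^T *m Q = 0.
  apply/relations_mul_proj/relations_product_mx.
  (* The matrix unit at [(a, b)] pairs slice [a] of [y] with the entries in row [b] of the
     products. *)
  apply/rowP => p; case/mxvec_indexP: p => b e.
  have : y *m ((delta_mx a b *t Q) *m W) = 0.
    move: yM; rewrite /orbit_mx mul_mxrow -mxrow0 => /eq_mxrowP.
    move=> /(_ (mxvec_index a b)).
    by rewrite /matrix_unit vec_mx_delta.
  rewrite tensmx_decr -mulmxA dilation_range => /rowP/(_ e).
  have yE b' q : (y *m (delta_mx a b *t 1%:M)) 0 (mxtens_index (b', q))
      = c a q 0 *+ (b' == b).
    rewrite mxE sum_mxtens_index (bigD1 a) //= [X in _ + X]big1 => [|a' neq_a'a].
      rewrite addr0 (bigD1 q) //= big1 => [|q' neq_q'q].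
        by rewrite addr0 tensmxE !mxE !eqxx mulr1 mulr_natr.
      by rewrite tensmxE !mxE (negbTE neq_q'q) !mulr0.
    by apply: big1 => q' _; rewrite tensmxE mxE (negbTE neq_a'a) mul0r mulr0.
  rewrite mulmxA mxE sum_mxtens_index (bigD1 b) //= [X in _ + X]big1; last first.
    by move=> b' /negbTE neq; apply: big1 => q _; rewrite yE neq mul0r.
  rewrite addr0 [RHS]mxE => yW0; rewrite mxE [RHS]mxE -[RHS]yW0.
  apply: eq_bigr => q _; rewrite yE eqxx product_mxE dilationE.
  by rewrite mxE.
apply/rowP => p; case: (mxtens_indexP p) => a q.
have /rowP/(_ q) := cQ a; rewrite mxE [RHS]mxE => cQ0.
rewrite mxE [RHS]mxE sum_mxtens_index.
rewrite (bigD1 a) //= [X in _ + X]big1 => [|a' neq_a'a]; last first.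
  by apply: big1 => q' _; rewrite tensmxE mxE (negbTE neq_a'a) mul0r mulr0.
rewrite addr0 -[RHS]cQ0; apply: eq_bigr => q' _.
by rewrite tensmxE !mxE eqxx mul1r.
Qed.

Lemma composite_RN_derivative Phi (D : 'M[C]_r) : positive_op D ->
  (forall A, Phi A = submap V D (kraus L A)) ->
  is_RN_derivative (composite_rep V L) W Phi
    (1%:M *t (Q *m (1%:M *t D) *m Q)).
Proof.
move=> D_ge0 PhiE; have [Qh Qi] := Qproj; split.
- apply: positive_op_tens1; rewrite -{1}Qh; apply: positive_op_conj.
  exact: positive_op_tens1.
- by rewrite tensmx_mul mul1mx !mulmxA Qi.
- by move=> A; rewrite !tensmx_mul mul1mx mulmx1 !mulmxA Qi -(mulmxA _ Q Q) Qi.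
(* Both copies of [W] absorb a factor [1 (x) Q], which puts [Q] on each side of [1 (x) D]. *)
- move=> A; rewrite PhiE submap_kraus_dilation -{1 2}dilation_range.
  rewrite adjmx_mul adjmx_tens adjmx1 -/Q Qh -!mulmxA (mulmxA (A *t _)).
  rewrite (mulmxA (1%:M *t Q)) !tensmx_mul mul1mx mulmx1 (mulmxA _ _ W).
  by rewrite tensmx_mul mulmx1 !mulmxA Qi.
Qed.

(** The compression is a linear map meeting the defining condition, so the choice is not the default
    0. Uniqueness of derivatives identifies the values, and [0 < l] permits cancelling [1 (x) _]. *)
Lemma transfer_mapE (Lam : 'M[C]_l -> 'M[C]_m) (D : 'M[C]_r) : (0 < l)%N ->
  (forall A, Lam A = kraus L A) -> positive_op D ->
  transfer_map V L Lam D = Q *m (1%:M *t D) *m Q.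
Proof.
move=> l_gt0 LamE D_ge0.
pose G D := Q *m (1%:M *t D) *m Q.
have linG : linear G.
  by move=> a X Y; rewrite /G tensmx_linearr mulmxDr mulmxDl
    -scalemxAr -scalemxAl.
pose g : {linear 'M[C]_r -> 'M[C]_(s * r)} :=
  HB.pack G (GRing.isLinear.Build _ _ _ _ _ linG).
have RN_G B : positive_op B -> is_RN_derivative (composite_rep V L) W
    (submap V B \o Lam) (1%:M *t G B).
  by move=> B_ge0; apply: composite_RN_derivative => // A; rewrite /= LamE.
have RN_T : is_RN_derivative (composite_rep V L) W (submap V D \o Lam)
    (1%:M *t transfer_map V L Lam D).
  rewrite /transfer_map; case: xgetP => [T _ RN_T|/(_ (linfun g))[]].
    exact: RN_T.
  by move=> B B_ge0; rewrite lfunE; exact: RN_G.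
apply: (tens1mx_inj l_gt0).
apply: RN_derivative_unique RN_T (RN_G D D_ge0).
exact: (@composite_rep_minimal (kraus V \o kraus L)).
Qed.

(** Invariance means [Q A Q = A Q]; adjoints of both sides give [Q A Q = Q A]. *)
Lemma reduces_coefficient_space (A : 'M[C]_(s * r)) : A^t* = A ->
  reduces (coefficient_space V L) A <-> Q *m A = A *m Q.
Proof.
move=> Ah; have [Qh Qi] := Qproj; rewrite /reduces Ah; split=> [[inv _]|QA].
  have AQ : Q *m (A *m Q) = A *m Q.
    apply: coefficient_proj_id => j; rewrite col_mulmx.
    exact/inv/coefficient_space_proj.
  by rewrite -{1}Qh -{1}Ah -adjmx_mul -AQ !adjmx_mul Ah Qh mulmxA.
suff inv : invariant_under (coefficient_space V L) A by [].
move=> x /coefficient_spaceP Qx; apply/coefficient_spaceP.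
by rewrite mulmxA QA -mulmxA Qx.
Qed.

End Composite.

Theorem corollary4p2 (R : realType) (l m n r s : nat)
    (Omega : 'M[R[i]]_m -> 'M[R[i]]_n) (Lambda : 'M[R[i]]_l -> 'M[R[i]]_m)
    (V : 'I_r -> 'M[R[i]]_(m, n)) (L : 'I_s -> 'M[R[i]]_(l, m))
    (P : 'M[R[i]]_r) :
  completely_positive Omega -> completely_positive Lambda ->
  (forall B, Omega B = kraus V B) -> free [tuple V i | i < r] ->
  (forall A, Lambda A = kraus L A) ->
  Omega \o Lambda <> (fun=> 0) ->
  projection_op P ->
  [<-> sharp (Omega \o Lambda) (submap V P \o Lambda);
       projection_op (transfer_map V L Lambda P);
       reduces (coefficient_space V L) (1%:M *t P);
       coefficient_proj V L *m (1%:M *t P) =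
         (1%:M *t P) *m coefficient_proj V L].
Proof.
move=> _ LamCP OmE _ LamE comp_neq0 Pproj.
(* If [l = 0], each [L j] has no rows, so [Lambda], and with it the composite, is zero. *)
have l_gt0 : (0 < l)%N.
  rewrite lt0n; apply/eqP => l0; apply: comp_neq0; apply/funext => A /=.
  rewrite OmE LamE.
  have -> : kraus L A = 0.
    by subst l; apply: big1 => j _; rewrite (flatmx0 (L j)) mulmx0.
  by apply: big1 => i _; rewrite mulmx0 mul0mx.
have P_ge0 := positive_op_projection Pproj.
have [Qproj _] := coefficient_projP V L.
have PIproj := projection_op_tens (projection_op1 _ s) Pproj.
have TE := transfer_mapE V l_gt0 LamE P_ge0.
have mini : minimal_stinespring (composite_rep V L) (dilation V L) (Omega \o Lambda).
  by apply: composite_rep_minimal => A; rewrite /= OmE LamE.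
have RN : is_RN_derivative (composite_rep V L) (dilation V L)
    (submap V P \o Lambda) (1%:M *t transfer_map V L Lambda P).
  by rewrite TE; apply: composite_RN_derivative => // A; rewrite /= LamE.
tfae.
(* Sharpness may be witnessed in any minimal representation; the projection property is carried to
   the one on [coefficient_space]. *)
- move=> [_ _ [d [sigma [T [E [mini' RN' Eproj]]]]]].
  exact: projection_op_tens1 l_gt0 (RN_derivative_projection mini' mini RN' RN Eproj).
- rewrite TE => /(projection_op_compression PIproj Qproj) QP.
  by apply/reduces_coefficient_space => //; case: PIproj.
- by move=> /reduces_coefficient_space -> //; case: PIproj.
(* Commutation makes the transfer value a projection, so the representation on [coefficient_space]
   witnesses sharpness. *)
- move=> /(projection_op_compression PIproj Qproj); rewrite -TE => Tproj.
  split.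
  + exact: completely_positive_comp (submap_projection_completely_positive V Pproj) LamCP.
  + have := completely_positive_comp (submap_projection_le V Pproj) LamCP.
    rewrite /cp_le; congr completely_positive; apply/funext => A /=.
    by rewrite OmE.
  + exists _, (composite_rep V L), (dilation V L), (1%:M *t transfer_map V L Lambda P).
    by split=> //; exact: projection_op_tens (projection_op1 _ l) Tproj.
Qed.
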